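(* Let $p$ be a positive integer with $p\neq 2$, and let $G$ be a connected $\mathbf{W}_{p}$ graph with $n=n(G)$ and $\alpha=\alpha(G)$. If \[ \frac{\alpha^{2}}{4(\alpha+1)}\leq p\quad\text{and}\quad n\in\left[(p+1)\cdot\alpha,\; p\cdot\alpha+2\sqrt{p\cdot\alpha+p}\right], \] or \[ \frac{\alpha(\alpha-1)}{\alpha+1}\leq p\quad\text{and}\quad n\in\left(p\cdot\alpha+2\sqrt{p\cdot\alpha+p},\; \frac{(\alpha^{2}+1)\cdot p+(\alpha-1)^{2}}{\alpha-1}\right], \] then the independence polynomial $I(G;x)$ is log-concave.
   Context: All graphs are finite, simple, undirected and loopless; $n(G)$ is the number of vertices. An independent set is a set of pairwise non-adjacent vertices; $\alpha(G)$ is the maximum size of an independent set, and a maximum independent set is one of size $\alpha(G)$. For a positive integer $p$, $G$ is a $\mathbf{W}_{p}$ graph if $n(G)\geq p$ and for every $p$ pairwise disjoint independent sets $A_1,\ldots,A_p$ of $G$ there exist $p$ pairwise disjoint maximum independent sets $S_1,\ldots,S_p$ of $G$ with $A_i\subseteq S_i$ for $1\le i\le p$. The independence polynomial is $I(G;x)=\sum_{k=0}^{\alpha(G)} s_k x^k$, where $s_k$ is the number of independent sets of size $k$ in $G$; it is log-concave if $s_k^2\geq s_{k-1}s_{k+1}$ for all $1\le k\le \alpha(G)-1$. *)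

(* Defs.v *)
From mathcomp Require Import all_boot all_order all_algebra.

Set Implicit Arguments.
Unset Strict Implicit.
Unset Printing Implicit Defensive.

Import GRing.Theory Num.Theory.
Local Open Scope ring_scope.

Record sgraph := SGraph {
  vertex :> finType;
  adj : rel vertex;
  adj_sym : symmetric adj;
  adj_irr : irreflexive adj
}.

Definition connected_graph (G : sgraph) : Prop :=
  forall x y : G, connect (@adj G) x y.

(* Taking x = y is harmless here, since adj is irreflexive. *)
Definition indep (G : sgraph) (A : {set G}) : bool :=
  [forall x in A, forall y in A, ~~ adj x y].

Definition alpha (G : sgraph) : nat := \max_(A : {set G} | indep A) #|A|.

Definition max_indep (G : sgraph) (A : {set G}) : bool :=
  indep A && (#|A| == alpha G)%N.

Definition pairwise_disjoint (T : finType) (p : nat) (A : 'I_p -> {set T}) :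
  Prop := forall i j : 'I_p, i != j -> [disjoint A i & A j].

Definition W (p : nat) (G : sgraph) : Prop :=
  (p <= #|G|)%N /\
  forall A : 'I_p -> {set G},
    (forall i, indep (A i)) -> pairwise_disjoint A ->
    exists S : 'I_p -> {set G},
      [/\ forall i, max_indep (S i),
          pairwise_disjoint S &
          forall i, A i \subset S i].

Definition nb_indep (G : sgraph) (k : nat) : nat :=
  #|[set A : {set G} | indep A & #|A| == k]|.

Definition indep_poly (G : sgraph) : {poly int} :=
  \sum_(k < (alpha G).+1) (nb_indep G k)%:R *: 'X^k.

(* The index k runs over 1 <= k <= deg P - 1, with deg P = (size P).-1.
   For P = indep_poly G the degree is alpha G: see size_indep_poly. *)
Definition log_concave (P : {poly int}) : Prop :=
  forall k : nat, (0 < k < (size P).-1)%N -> P`_k.-1 * P`_k.+1 <= P`_k ^+ 2.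

Lemma indep0 (G : sgraph) : indep (set0 : {set G}).
Proof. by apply/forall_inP => x; rewrite inE. Qed.

Lemma coef_indep_poly (G : sgraph) (k : nat) :
  (indep_poly G)`_k = (nb_indep G k)%:R.
Proof.
rewrite /indep_poly -(poly_def _ (fun k => (nb_indep G k)%:R)) coef_poly.
case: ltnP => // gt_k; suff -> : nb_indep G k = 0%N by [].
apply/eqP; rewrite cards_eq0; apply/eqP/setP => A; rewrite !inE.
apply/negP => /andP[iA /eqP cA].
move: gt_k; rewrite -cA ltnNge => /negP; apply.
exact: (leq_bigmax_cond (F := fun A : {set G} => #|A|)).
Qed.

Lemma size_indep_poly (G : sgraph) : size (indep_poly G) = (alpha G).+1.
Proof.
rewrite /indep_poly -(poly_def _ (fun k => (nb_indep G k)%:R)).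
apply: size_poly_eq; rewrite pnatr_eq0 cards_eq0.
have gt0 : (0 < #|[pred A : {set G} | indep A]|)%N.
  by apply/card_gt0P; exists set0; rewrite inE indep0.
have [A iA eA] := eq_bigmax_cond (fun A : {set G} => #|A|) gt0.
by apply/set0Pn; exists A; rewrite inE; move: iA; rewrite inE => -> /=; rewrite -eA.
Qed.

(* Main.v *)
(** In a [W p] graph, deleting [N[A]] for an independent set [A] of size [k] leaves
    at least [p * (alpha - k)] vertices. For [p <> 2] and a connected graph with
    [alpha > 1], moreover [|N(A)| >= p |A|], so at most [n - (p + 1) * k] vertices
    remain. Counting the one-point extensions of independent sets, this gives
      [p (alpha - k) s_k <= (k + 1) s_(k+1) <= (n - (p + 1) k) s_k],
    and log-concavity at [k] follows as soon as
      [n <= p alpha + p (alpha + 1) / k + k].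

    For [|N(A)| >= p |A|], each [v] in [A] has at least [p - 1] private neighbours,
    and if it has exactly [p - 1] then they form with [v] a clique which is a
    component once the closed neighbourhood of the rest of [A] is deleted. The
    critical case is a set [T] all of whose vertices have [p - 1] private neighbours,
    the set [C] of common neighbours containing all the other neighbours. A maximal
    independent subset [B] of [C] then dominates all private neighbours; in a maximum
    independent set extending [B], exchanging [B] for [T] gives [|T| <= |B| <= |C|].
    The domination fails for [p = 2] in the 5-cycle. *)

Require Import Defs.
From mathcomp Require Import all_boot all_order all_algebra.
From mathcomp Require Import zify ring lra.

Import Order.TTheory GRing.Theory Num.Theory.

Section Robust.

Set Implicit Arguments.
Unset Strict Implicit.
Unset Printing Implicit Defensive.

Variable G : sgraph.
Implicit Types (A B S T U X : {set G}) (u v w x y z : G).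

(* [lia] does not return in contexts with many membership facts over [G]. *)
Ltac card_lia :=
  repeat match goal with
  | H : @eq ?T _ _ |- _ => unify T nat; revert H
  | H : ~ @eq ?T _ _ |- _ => unify T nat; revert H
  | H : is_true (leq _ _) |- _ => revert H
  | H : is_true (_ != _ :> nat) |- _ => revert H
  end;
  repeat match goal with |- context [card ?A] => generalize (card A) end;
  clear; lia.

(** * Independent sets and neighbourhoods *)

Lemma indepP A : reflect {in A &, forall x y, ~~ adj x y} (indep A).
Proof.
apply: (iffP forall_inP) => h x => [y xA|xA]; first by move/forall_inP: (h x xA); apply.
by apply/forall_inP => y; exact: h.
Qed.

Lemma indepS A B : A \subset B -> indep B -> indep A.
Proof.
by move=> /subsetP sAB /indepP iB; apply/indepP => x y xA yA; apply: iB; exact: sAB.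
Qed.

Lemma indepU A B : indep A -> indep B ->
  {in A & B, forall x y, ~~ adj x y} -> indep (A :|: B).
Proof.
move=> /indepP iA /indepP iB iAB; apply/indepP => x y.
rewrite !inE => /orP[] xA /orP[] yA; [exact: iA | exact: iAB | | exact: iB].
by rewrite adj_sym iAB.
Qed.

Lemma indep1 x : indep [set x].
Proof. by apply/indepP => y z /set1P -> /set1P ->; rewrite adj_irr. Qed.

Lemma indepU1 x A : indep A -> {in A, forall y, ~~ adj x y} -> indep (x |: A).
Proof.
by move=> iA h; apply: indepU iA _ => [|y z /set1P -> /h //]; exact: indep1.
Qed.

Definition nbrs U v := [set x in U | adj v x].

Definition nbrs_of U A := [set x in U | [exists v in A, adj v x]].

(** This is [U] with the closed neighbourhood of [A] deleted. *)
Definition far U A := [set y in U | (y \notin A) && [forall x in A, ~~ adj x y]].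

Lemma farP U A y :
  reflect [/\ y \in U, y \notin A & {in A, forall x, ~~ adj x y}] (y \in far U A).
Proof.
rewrite inE; apply: (iffP and3P) => -[yU yA h]; split=> //; exact/forall_inP.
Qed.

Lemma far_sub U A : far U A \subset U.
Proof. by apply/subsetP => x /farP[]. Qed.

Lemma card_far U A : A \subset U -> indep A ->
  #|U| = (#|A| + #|nbrs_of U A| + #|far U A|)%N.
Proof.
move=> /subsetP AU /indepP iA.
rewrite -(cardsID A U) -addnA; congr (_ + _)%N.
  by apply: eq_card => x; rewrite inE; case xA: (x \in A); rewrite ?andbF ?AU.
rewrite -(cardsID (nbrs_of U A) (U :\: A)); congr (_ + _)%N; apply: eq_card => x.
  rewrite !inE; case xU: (x \in U); rewrite ?andbF //= andbT.
  case: exists_inP; rewrite ?andbF // => -[v vA vx]; rewrite andbT.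
  by apply/negP => xA; move: (iA _ _ vA xA); rewrite vx.
rewrite !inE negb_and; case xU: (x \in U); rewrite ?andbF //= andbT.
by rewrite negb_exists_in andbC.
Qed.

(** A neighbour of [T] that no vertex of [A :\: T] sees lies in [far U (A :\: T)], since
    independence keeps it out of [A]. This serves an induction that peels [T] off [A]. *)
Lemma nbrs_of_split U A T : T \subset A -> indep A ->
  #|nbrs_of U A| = (#|nbrs_of U (A :\: T)| + #|nbrs_of (far U (A :\: T)) T|)%N.
Proof.
move=> /subsetP TA /indepP iA.
rewrite -(cardsID (nbrs_of U (A :\: T)) (nbrs_of U A)); congr (_ + _)%N.
  apply: eq_card => x; rewrite !inE; case xU: (x \in U) => //=.
  apply/andP/idP => [[]//|h]; split=> //.
  case/exists_inP: h => v /setDP[vA _] vx.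
  by apply/exists_inP; exists v.
apply: eq_card => x; rewrite !inE; case xU: (x \in U); rewrite ?andbF //=.
rewrite negb_exists_in; apply/andP/andP => -[].
  move=> h1 /exists_inP[v vA vx]; split; last first.
    apply/exists_inP; exists v => //; apply: contraLR vx => vT.
    by move/forall_inP: h1; apply; rewrite inE vT.
  rewrite h1 andbT negb_and negbK.
  apply/orP; right; apply/negP => xA.
  by move: (iA _ _ vA xA); rewrite vx.
case/andP=> _ h1 /exists_inP[v vT vx]; split=> //.
by apply/exists_inP; exists v; rewrite ?TA.
Qed.

(** * Robust vertex sets *)

(* In Staples' terms: deleting fewer than [p] vertices from the subgraph induced
   on [U] leaves a well-covered graph with the same independence number [a].
   Unlike the definition of [W], this is visibly inherited by [far U A]. *)
Definition robust p U a :=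
  (forall S, indep S -> S \subset U -> #|S| <= a) /\
  (forall B X, indep B -> B \subset U -> #|X| < p -> [disjoint B & X] ->
    exists S, [/\ indep S, S \subset U, B \subset S, [disjoint S & X] & #|S| = a]).

(** Take [B] as one of the [p] disjoint sets and the singletons of [X] as others, padded with empty
    sets: the maximum independent set assigned to [B] then avoids [X]. *)
Lemma robust_W p : 0 < p -> W p G -> robust p [set: G] (alpha G).
Proof.
move=> p0 [_ hW]; split=> [S iS _|B X iB _ ltX dBX].
  exact: (leq_bigmax_cond (F := fun A : {set G} => #|A|)).
pose F (i : nat) : {set G} :=
  if i is j.+1 then [set x | (x \in X) && (index x (enum X) == j)] else B.
have F0 i x : x \in F i.+1 -> x \in X by rewrite inE => /andP[].
have iF (i : 'I_p) : indep (F i).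
  case: i => -[|j] //= _; apply/indepP => x y; rewrite !inE.
  case/andP=> xX /eqP jx /andP[yX /eqP jy].
  rewrite -(@nth_index _ x x (enum X)) ?mem_enum // jx -jy nth_index ?mem_enum //.
  by rewrite adj_irr.
have dF : pairwise_disjoint (fun i : 'I_p => F i).
  move=> [[|i] ?] [[|j] ?] //= ne.
  - by apply: disjointWr dBX; apply/subsetP => x /F0.
  - by rewrite disjoint_sym; apply: disjointWr dBX; apply/subsetP => x /F0.
  - rewrite disjoint_subset; apply/subsetP => x; rewrite !inE => /andP[-> /eqP ->] /=.
    by move: ne; rewrite -val_eqE /= eqSS.
have [S [mS dS sS]] := hW _ iF dF.
pose i0 := Ordinal p0.
exists (S i0); have /andP[iS /eqP cS] := mS i0; split=> //; first exact: sS i0.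
rewrite disjoint_sym disjoint_subset; apply/subsetP => x xX; rewrite inE.
have lt : (index x (enum X)).+1 < p.
  by apply: leq_ltn_trans ltX; rewrite cardE index_mem mem_enum.
have xS : x \in S (Ordinal lt).
  by apply: (subsetP (sS (Ordinal lt))); rewrite inE xX /=.
have := dS (Ordinal lt) i0; rewrite -val_eqE /= => /(_ isT).
by rewrite disjoint_subset => /subsetP/(_ _ xS); rewrite inE.
Qed.

Lemma disjoint_far U A : [disjoint A & far U A].
Proof.
rewrite disjoint_sym disjoint_subset; apply/subsetP => x /farP[_ xA _].
by rewrite inE.
Qed.

(** Extend [A :|: B] inside [U], then discard [A]. Vertices of [X] lying in [A] are exempted from
    deletion, as [A] has to survive the extension. *)
Lemma robust_far p U a A : robust p U a -> A \subset U -> indep A ->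
  robust p (far U A) (a - #|A|).
Proof.
move=> [max ext] AU iA.
have iAU S : indep S -> S \subset far U A -> indep (A :|: S).
  move=> iS /subsetP SF; apply: indepU => // x y xA /SF/farP[_ _]; exact.
have sAU S : S \subset far U A -> A :|: S \subset U.
  by move=> SF; rewrite subUset AU (subset_trans SF) // far_sub.
split=> [S iS SF|B X iB BF ltX dBX].
  have := max _ (iAU S iS SF) (sAU S SF).
  rewrite cardsU; have -> : A :&: S = set0.
    apply: disjoint_setI0; exact: disjointWr SF (disjoint_far U A).
  by rewrite cards0; card_lia.
have [|S [iS SU]] := ext (A :|: B) (X :\: A) (iAU _ iB BF) (sAU _ BF) (leq_ltn_trans (subset_leq_card (subsetDl _ _)) ltX).
  rewrite disjoint_subset; apply/subsetP => x; rewrite !inE.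
  case xA: (x \in A) => //= xB.
  by move: dBX; rewrite disjoint_subset => /subsetP/(_ _ xB); rewrite inE.
rewrite subUset => /andP[AS BS] dS cS.
exists (S :\: A); split.
- exact: indepS (subsetDl _ _) iS.
- apply/subsetP => x /setDP[xS xA]; apply/farP; split=> // [|y yA].
    exact: (subsetP SU).
  by move/indepP: iS; apply=> //; exact: (subsetP AS).
- apply/subsetP => x xB; rewrite inE (subsetP BS) // andbT.
  by case/farP: (subsetP BF _ xB).
- rewrite disjoint_subset; apply/subsetP => x /setDP[xS xA]; rewrite inE.
  by move: dS; rewrite disjoint_subset => /subsetP/(_ _ xS); rewrite !inE xA.
- by rewrite cardsD (setIidPr AS) cS.
Qed.

(** If [v] could be deleted with all its neighbours, a surviving independent set of size [a] would
    still accept [v]. *)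
Lemma robust_deg p U a v : robust p U a -> v \in U -> p <= #|nbrs U v|.+1.
Proof.
move=> [max ext] vU; rewrite leqNgt; apply/negP => lt.
have vN : v \notin nbrs U v by rewrite inE adj_irr andbF.
have [||S [iS SU _ dS cS]] := ext set0 (v |: nbrs U v) (indep0 G) (sub0set _).
- by rewrite cardsU1 vN.
- by rewrite -setI_eq0 set0I.
have dS' x : x \in S -> (x != v) && ~~ adj v x.
  move=> xS; move: dS; rewrite disjoint_subset => /subsetP/(_ _ xS).
  by rewrite !inE (subsetP SU) // negb_or.
have := max (v |: S); rewrite cardsU1.
have -> : v \notin S by apply/negP => /dS'; rewrite eqxx.
rewrite cS add1n ltnn => h; suff: false by [].
apply: h; last by rewrite subUset sub1set vU.
by apply: indepU1 => // x /dS'/andP[].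
Qed.

(** Each induction step removes a closed neighbourhood, of at least [p] vertices by [robust_deg],
    and lowers [a] by one. *)
Lemma robust_card p U a : robust p U a -> p * a <= #|U|.
Proof.
elim: a U => [|a IH] U rU; first by rewrite muln0.
case: p => [//|p] in rU IH *.
have [S [iS SU _ _ cS]] := rU.2 set0 set0 (indep0 G) (sub0set _)
  ltac:(by rewrite cards0) ltac:(by rewrite -setI_eq0 set0I).
have /set0Pn[v vS] : S != set0 by rewrite -cards_eq0 cS.
have vU := subsetP SU _ vS.
have v1 : [set v] \subset U by rewrite sub1set.
have := robust_far rU v1 (indep1 v).
rewrite cards1 subSS subn0 => /IH le.
rewrite (card_far v1 (indep1 v)) cards1 mulnS leq_add // add1n.
apply: leq_trans (robust_deg rU vU) _; rewrite ltnS; apply: subset_leq_card.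
apply/subsetP => x; rewrite !inE => /andP[-> vx].
by apply/exists_inP; exists v; rewrite ?inE.
Qed.

Lemma robust_nbrs p U a A v n : robust p U a -> A \subset U -> indep A ->
  v \in far U A -> #|nbrs (far U A) v| <= n -> p <= n.+1.
Proof.
move=> rU AU iA vF le.
exact: leq_trans (robust_deg (robust_far rU AU iA) vF) _.
Qed.

(** * Vertices of degree below [p] *)

(* A vertex [y] outside [N[v]] adjacent to a neighbour of [v] would lower the
   degree of [v] in [far U [set y]]. *)
Lemma min_deg_closed p U a v x y : robust p U a -> v \in U ->
  #|nbrs U v| < p -> x \in nbrs U v -> y \in nbrs U x -> y != v -> adj v y.
Proof.
move=> rU vU lt; rewrite !inE => /andP[xU vx] /andP[yU xy] yv.
apply/negPn/negP => vy.
have y1 : [set y] \subset U by rewrite sub1set.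
suff: #|nbrs (far U [set y]) v| < #|nbrs U v|.
  move=> lt2; have := robust_nbrs rU y1 (indep1 y) (v := v) _ (leqnn _).
   suff -> : v \in far U [set y] by move=> /(_ isT); card_lia.
  apply/farP; split=> //; first by rewrite inE eq_sym.
  by move=> z /set1P ->; rewrite adj_sym.
apply: proper_card; apply/properP; split.
  by apply/subsetP => z; rewrite !inE => /andP[/andP[-> _] ->].
exists x; rewrite !inE ?xU //= negb_and; apply/orP; left.
rewrite negb_and; apply/orP; right; apply/negP => /forall_inP/(_ y).
by rewrite inE eqxx adj_sym xy => /(_ isT).
Qed.

(** Otherwise some [S] of size [a] contains [x] and [y] but avoids [v] and its other neighbours.
    Trading [x] and [y] for [v] and one further vertex [w] gives another such set. As [S] cannot
    grow, [w] sees [x] or [y], and [min_deg_closed] makes it a neighbour of [v], against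
    independence. *)
Lemma min_deg_clique p U a v x y : robust p U a -> v \in U ->
  #|nbrs U v| < p -> x \in nbrs U v -> y \in nbrs U v -> x != y -> adj x y.
Proof.
move=> rU vU lt; rewrite !inE => /andP[xU vx] /andP[yU vy] xy.
apply/negPn/negP => nxy.
have vn z : adj v z -> z != v by move=> vz; apply: contraL vz => /eqP ->; rewrite adj_irr.
pose X := v |: (nbrs U v :\ x :\ y).
have cX : #|X| < p.
  rewrite /X cardsU1 !inE adj_irr !andbF /=.
  have := cardsD1 x (nbrs U v); rewrite inE xU vx /=.
  have := cardsD1 y (nbrs U v :\ x); rewrite !inE yU vy eq_sym xy /=; card_lia.
have iB : indep [set x; y].
  by apply: indepU1; [exact: indep1 | move=> z /set1P ->].
have BU : [set x; y] \subset U by rewrite subUset !sub1set xU.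
have [|S [iS SU BS dS cS]] := rU.2 _ _ iB BU cX.
  rewrite disjoint_subset; apply/subsetP => z; rewrite !inE negb_or.
  by case/orP=> /eqP ->; rewrite vn // eqxx ?andbF.
have [xS yS] : x \in S /\ y \in S by split; apply: (subsetP BS); rewrite !inE eqxx ?orbT.
pose S0 := S :\ x :\ y.
have cS0 : #|S0|.+2 = a.
  by rewrite -cS (cardsD1 x S) xS (cardsD1 y (S :\ x)) !inE yS (eq_sym y) xy.
have S0v z : z \in S0 -> [/\ z \in S, z \in U, z != v & ~~ adj v z].
  rewrite !inE => /and3P[zy zx zS]; have zU := subsetP SU _ zS.
  move: dS; rewrite disjoint_subset => /subsetP/(_ _ zS).
  by rewrite !inE zU zy zx /= negb_or => /andP[].
have vS0 : v \notin S0 by apply/negP => /S0v[_ _]; rewrite eqxx.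
have iS0 : indep S0 by apply: indepS iS; rewrite !subDset !subsetU ?subxx ?orbT.
have [||||S1 [iS1 S1U vS1 _ cS1]] := rU.2 (v |: S0) set0.
- by apply: indepU1 => // z /S0v[].
- by rewrite subUset sub1set vU; apply/subsetP => z /S0v[].
- by rewrite cards0; apply: leq_ltn_trans cX.
- by rewrite -setI_eq0 setI0.
have /set0Pn[w] : S1 :\: (v |: S0) != set0.
  by rewrite -cards_eq0 cardsD (setIidPr vS1) cardsU1 vS0 cS1 -cS0 add1n subSnn.
rewrite in_setD in_setU1 negb_or => /andP[/andP[wv wS0] wS1].
have [vS1' wU] : v \in S1 /\ w \in U by rewrite (subsetP vS1) ?(subsetP S1U) // !inE eqxx.
move/indepP: (iS1) => hS1.
have nwv : ~~ adj v w by exact: hS1.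
(* [w] must see [x] or [y], as otherwise [x], [y], [w] and [S0] are independent. *)
have [z [zN wz]] : exists z, z \in nbrs U v /\ adj z w.
  case xw: (adj x w); first by exists x; rewrite inE xU vx.
  case yw: (adj y w); first by exists y; rewrite inE yU vy.
  suff : #|w |: S| <= a.
    rewrite cardsU1 cS; suff -> : w \notin S by rewrite add1n ltnn.
    apply/negP => wS; move: wS0; rewrite !inE wS andbT.
    case: eqVneq => [e|_]; first by rewrite e vy in nwv.
    by case: eqVneq => [e|_]; first by rewrite e vx in nwv.
  apply: rU.1; last by rewrite subUset sub1set wU.
  apply: indepU1 => // z zS; rewrite adj_sym.
  have [->|zx] := eqVneq z x; first by rewrite xw.
  have [->|zy] := eqVneq z y; first by rewrite yw.
  apply: hS1 => //; apply: (subsetP vS1); rewrite !inE zx zy zS orbT //.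
have := min_deg_closed (y := w) rU vU lt zN _ wv.
by rewrite inE wU wz (negPf nwv) => /(_ isT).
Qed.

Lemma setD1_neq A x y : (y \in A :\ x) = (y \in A) && (y != x).
Proof. by rewrite !inE andbC. Qed.

(** * The critical case: few private neighbours, all others common *)

Section MinimalObstruction.

Variables (p a : nat) (U T : {set G}) (c : G).
Hypotheses (p0 : 0 < p) (p2 : p != 2) (rU : robust p U a).
Hypotheses (TU : T \subset U) (iT : indep T) (T2 : 1 < #|T|).

(** The private neighbours of [v] with respect to [T]. By [robust_deg] the bound [cP] below leaves
    exactly [p - 1] of them. *)
Let P v := nbrs (far U (T :\ v)) v.
Let C := [set u in U | [forall z in T, adj z u]].

Hypothesis cP : {in T, forall v, #|P v| < p}.
Hypothesis all_or_one : forall u v w z, u \in U ->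
  v \in T -> w \in T -> z \in T -> v != w -> adj v u -> adj w u -> adj z u.
Hypothesis cC : c \in C.

Let PP v x : v \in T -> reflect
  [/\ x \in U, x \notin T, adj v x & {in T, forall w, w != v -> ~~ adj w x}] (x \in P v).
Proof.
move=> vT; rewrite inE; apply: (iffP andP).
  move=> [/farP[xU xT h] vx]; split=> //.
    apply: contraL vx => xT'; exact: (indepP _ iT).
  by move=> w wT wv; apply: h; rewrite setD1_neq wT.
move=> [xU xT vx h]; split=> //; apply/farP; split=> //.
  by rewrite setD1_neq negb_and xT.
by move=> w; rewrite setD1_neq => /andP[]; exact: h.
Qed.

Let CP u : reflect (u \in U /\ {in T, forall z, adj z u}) (u \in C).
Proof. by rewrite inE; apply: (iffP andP) => -[-> h]; split=> //; apply/forall_inP. Qed.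

Let CorP u v : u \in U -> v \in T -> adj v u -> u \notin C -> u \in P v.
Proof.
move=> uU vT vu uC; apply/(PP _ vT); split=> //.
  by apply: contraL vu => uT; exact: (indepP _ iT).
move=> w wT wv; apply: contra uC => wu; apply/CP; split=> // z zT.
by apply: (all_or_one uU vT wT zT _ vu wu); rewrite eq_sym.
Qed.

(** With [A] made of [y] and [T] without [v] and [w], the vertex [v] keeps at least [p - 1]
    neighbours in [far U A]. These lie in [P v] away from [y], or in [C]; the latter needs [T] to be
    just [v] and [w], as any third vertex of [T] is in [A] and sees all of [C]. *)
Let cross v w y : v \in T -> w \in T -> v != w -> y \in P w ->
  #|[set z in P v | adj y z]| <= if #|T| == 2 then #|C| else 0.
Proof.
move=> vT wT vw /(PP _ wT)[yU yT wy hy].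
pose A := y |: (T :\ v :\ w).
have AU : A \subset U.
  by rewrite subUset sub1set yU; apply: subset_trans TU; rewrite !subDset !subsetU ?subxx ?orbT.
have iA : indep A.
  apply: indepU1.
    by apply: indepS iT; rewrite !subDset !subsetU ?subxx ?orbT.
  by move=> z; rewrite !setD1_neq adj_sym => /andP[/andP[zT _] zw]; exact: hy.
have vF : v \in far U A.
  apply/farP; split; first exact: (subsetP TU).
    by rewrite in_setU1 !setD1_neq eqxx andbF orbF; apply: contra yT => /eqP <-.
  move=> z /setU1P[->|]; first by rewrite adj_sym hy.
  by rewrite !setD1_neq => /andP[/andP[zT _] _]; exact: (indepP _ iT).
pose C' := if #|T| == 2 then C else set0.
have sub : nbrs (far U A) v \subset [set z in P v | ~~ adj y z] :|: C'.
  apply/subsetP => z; rewrite inE => /andP[/farP[zU zA hz] vz].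
  case zC: (z \in C); last first.
    by rewrite inE inE CorP ?zC // hz // in_setU1 eqxx.
  rewrite inE /C'; case: eqP => [_|cT]; first by rewrite zC orbT.
  have /set0Pn[u uT] : T :\ v :\ w != set0.
    rewrite -cards_eq0; have := cardsD1 v T; rewrite vT.
    have := cardsD1 w (T :\ v); rewrite setD1_neq wT eq_sym vw; card_lia.
  have /CP[_ /(_ u)] := zC.
  have uA : u \in A by rewrite in_setU1 uT orbT.
  move: uT; rewrite !setD1_neq => /andP[/andP[uT _] _] /(_ uT).
  by rewrite (negPf (hz _ uA)).
have := robust_nbrs rU AU iA vF (subset_leq_card sub).
have -> : (if #|T| == 2 then #|C| else 0) = #|C'|.
  by rewrite /C'; case: ifP; rewrite ?cards0.
have := cardsUI [set z in P v | ~~ adj y z] C'.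
have -> : #|[set z in P v | ~~ adj y z]| = #|P v :\: [set z in P v | adj y z]|.
  by apply: eq_card => z; rewrite !inE; case: (_ && adj v z); rewrite ?andbF ?andbT.
have subP : [set z in P v | adj y z] \subset P v.
  by apply/subsetP => z; rewrite in_set => /andP[].
rewrite cardsD (setIidPr subP); have := cP vT; have := subset_leq_card subP.
card_lia.
Qed.

Let cT z : z \in T -> adj z c.
Proof. by move=> zT; case/CP: cC => _; apply. Qed.

(** An undominated [x] in [P v] has at least [p - 1] neighbours in [far U B], but at most [p - 2] of
    them in [P v]. So [x] sees some [y] in another [P w], and [cross] restricts such adjacencies
    until they contradict the clique property of [min_deg_clique]. *)
Let dominated B : c \in B -> maxset [pred B : {set G} | indep B && (B \subset C)] B ->
  #|C| < #|T| -> {in T, forall v, {in P v, forall x, exists2 b, b \in B & adj b x}}.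
Proof.
move=> cB /maxsetP[/andP[/= iB BC] maxB] ltCT v vT x xP.
apply/exists_inP; apply: contraT; rewrite negb_exists_in => /forall_inP hx.
have BU : B \subset U by apply: subset_trans BC _; apply/subsetP => z /CP[].
have /(PP _ vT)[xU xT vx hxT] := xP.
have xC : x \notin C.
  have /set0Pn[w] : T :\ v != set0.
    by rewrite -cards_eq0; have := cardsD1 v T; rewrite vT; card_lia.
  rewrite setD1_neq => /andP[wT wv]; apply/negP => /CP[_ /(_ w wT)].
  by rewrite (negPf (hxT _ wT wv)).
have xF : x \in far U B by apply/farP; split=> //; apply: contra xC; exact: (subsetP BC).
set D := nbrs (far U B) x.
have degx : p <= #|D|.+1 := robust_deg (robust_far rU BU iB) xF.
have cPx : #|P v :\ x|.+1 < p by have := cardsD1 x (P v); rewrite xP; have := cP vT; card_lia.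
have DP y : y \in D -> y \in P v :\ x \/ exists w, [/\ w \in T, w != v & y \in P w].
  rewrite inE => /andP[/farP[yU yB hy] xy].
  have yC : y \notin C.
    apply: contra yB => yC; rewrite -(maxB (y |: B)) ?subsetUr ?setU11 //.
    rewrite subUset sub1set yC BC /= andbT; apply: indepU1 => // z zB.
    by rewrite adj_sym hy.
  (* [c] is in [B] and sees all of [T], so nothing far from [B] is in [T]. *)
  have yT : y \notin T by apply: contra (hy _ cB) => /cT; rewrite adj_sym.
  case: (boolP [exists w in T :\ v, adj w y]) => [/exists_inP[w]|].
    rewrite setD1_neq => /andP[wT wv] wy.
    by right; exists w; split=> //; exact: CorP.
  rewrite negb_exists_in => /forall_inP hyT; left.
  rewrite setD1_neq andbC; have -> /= : y != x.
    by apply: contraL xy => /eqP ->; rewrite adj_irr.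
  (* Once [T :\ v] and its neighbours are deleted, [v] has degree below [p], so [min_deg_closed]
     makes the neighbour [y] of [x] a neighbour of [v]. *)
  have TvU : T :\ v \subset U by apply: subset_trans (subsetDl _ _) TU.
  have iTv : indep (T :\ v) by apply: indepS iT; exact: subsetDl.
  have yF : y \in far U (T :\ v).
    by apply/farP; split=> //; rewrite setD1_neq negb_and yT.
  have vF : v \in far U (T :\ v).
    apply/farP; split; rewrite ?setD1_neq ?eqxx ?andbF ?(subsetP TU) //.
    by move=> z; rewrite setD1_neq => /andP[zT _]; exact: (indepP _ iT).
  rewrite inE yF /=; apply: (min_deg_closed (robust_far rU TvU iTv) vF (cP vT) xP).
    by rewrite inE yF.
  by apply: contraNneq yT => ->.
case: (boolP (D \subset P v :\ x)) => [/subset_leq_card|/subsetPn[y yD yPx]]; first by card_lia.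
have [|[w [wT wv yP]]] := DP _ yD; first by rewrite (negPf yPx).
have xy : adj x y by move: yD; rewrite inE => /andP[].
have crossx u : u \in T -> u != v -> #|[set z in P u | adj x z]| <= if #|T| == 2 then #|C| else 0.
  by move=> uT uv; exact: cross uT vT uv xP.
have in_cross s z u : z \in P u -> adj s z -> z \in [set z in P u | adj s z].
  by move=> zP xz; rewrite inE zP.
(* For any other size, [cross] excludes the edge between [x] and [y]. *)
have T_eq2 : #|T| = 2.
  apply/eqP; have := crossx _ wT wv; case: ifP => // _.
  by rewrite leqn0 cards_eq0 => /eqP e; have := in_cross _ _ _ yP xy; rewrite e inE.
have C1 : #|C| <= 1 by rewrite -ltnS -T_eq2.
rewrite T_eq2 eqxx in crossx.
have DE : D \subset y |: (P v :\ x).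
  apply/subsetP => z zD; rewrite in_setU1 orbC.
  have [-> //|[u [uT uv zP]]] := DP _ zD.
  have xz : adj x z by move: zD; rewrite inE => /andP[].
  have eu : u = w.
    have : #|T :\ v| <= 1 by have := cardsD1 v T; rewrite vT T_eq2; card_lia.
    by move/card_le1_eqP => h; apply: h; rewrite setD1_neq ?wT ?uT.
  subst u; have /card_le1_eqP h := leq_trans (crossx _ wT wv) C1.
  by rewrite (h _ _ (in_cross _ _ _ yP xy) (in_cross _ _ _ zP xz)) eqxx orbT.
have eqD : D = y |: (P v :\ x).
  by apply/eqP; rewrite eqEcard DE cardsU1 yPx; card_lia.
have cD : #|D| = #|P v :\ x|.+1 by rewrite eqD cardsU1 yPx.
(* With no such [x2], [D] would be the single vertex [y], forcing [p = 2]. *)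
have [x2 x2P] : exists x2, x2 \in P v :\ x.
  by apply/set0Pn; rewrite -cards_eq0; move: p2; card_lia.
have x2D : x2 \in D by rewrite eqD in_setU1 x2P orbT.
have yx2 : adj y x2.
  apply: (min_deg_clique (robust_far rU BU iB) xF _ yD x2D); last by apply: contraNneq yPx => ->.
  by rewrite -/D cD.
have yP' : y \notin P v.
  apply/negP => /(PP _ vT)[_ _ _ /(_ w wT wv)].
  by case/(PP _ wT): yP => _ _ ->.
have vw : v != w by rewrite eq_sym.
have := cross vT wT vw yP; rewrite T_eq2 eqxx => /leq_trans/(_ C1)/card_le1_eqP/(_ x x2).
move: x2P; rewrite setD1_neq => /andP[x2P x2x] ex.
suff e : x2 = x by rewrite e eqxx in x2x.
by apply: ex; apply: in_cross; rewrite // adj_sym.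
Qed.

(** Exchange [B] for [T] in a set [S] of size [a] containing [B]. A vertex of [S :\: B] seen by [T]
    would either lie in [C] and enlarge [B], or be private and hence seen by [B]. *)
Lemma minimal_obstruction : #|T| <= #|C|.
Proof.
rewrite leqNgt; apply/negP => ltCT.
have [|B mB] := @maxset_exists _ [pred B : {set G} | indep B && (B \subset C)] [set c].
  by rewrite /= indep1 sub1set.
rewrite sub1set => cB.
have dom := dominated cB mB ltCT.
have /maxsetP[/andP[/= iB BC] maxB] := mB.
have BU : B \subset U by apply: subset_trans BC _; apply/subsetP => z /CP[].
have [||S [iS SU BS _ cS]] := rU.2 B set0 iB BU; rewrite ?cards0 //.
  by rewrite -setI_eq0 setI0.
have hS := indepP _ iS.
have SB_far u z : u \in S :\: B -> z \in T -> ~~ adj z u.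
  move=> /setDP[uS uB] zT; apply/negP => zu; have uU := subsetP SU _ uS.
  case: (boolP (u \in C)) => uC; last first.
    have [b bB bu] := dom z zT u (CorP uU zT zu uC).
    by move: (hS _ _ (subsetP BS _ bB) uS); rewrite bu.
  move/negP: uB; apply; rewrite -(maxB (u |: B)) ?subsetUr ?setU11 //.
  rewrite subUset sub1set uC BC /= andbT; apply: indepU1 => // b bB.
  by apply: hS => //; exact: (subsetP BS).
have TS : [disjoint T & S :\: B].
  rewrite disjoint_subset; apply/subsetP => z zT; rewrite inE; apply/negP => /setDP[zS _].
  by move: (hS _ _ zS (subsetP BS _ cB)); rewrite cT.
have := rU.1 (T :|: (S :\: B)); rewrite subUset TU (subset_trans (subsetDl _ _) SU) /=.
rewrite cardsU (disjoint_setI0 TS) cards0 cardsD (setIidPr BS) cS.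
have := subset_leq_card BS; rewrite cS; have := subset_leq_card BC.
move=> h1 h2 /(_ _ isT) h3; suff /h3 : indep (T :|: (S :\: B)) by card_lia.
apply: indepU => //; first by apply: indepS iS; exact: subsetDl.
by move=> z u zT uS; exact: SB_far.
Qed.

(** The sets [P v], each of size at least [p - 1], are disjoint from one another and from [C], which
    supplies the missing [#|T|] neighbours. *)
Lemma minimal_obstruction_nbrs : p * #|T| <= #|nbrs_of U T|.
Proof.
pose F v := if v \in T then P v else set0.
have dF v w : v != w -> [disjoint F v & F w].
  move=> vw; rewrite /F; case: ifP => vT; last by rewrite -setI_eq0 set0I.
  case: ifP => wT; last by rewrite -setI_eq0 setI0.
  rewrite disjoint_subset; apply/subsetP => x /(PP _ vT)[_ _ _ h]; rewrite inE.
  by apply/negP => /(PP _ wT)[_ _ wx _]; move: (h _ wT); rewrite eq_sym vw wx => /(_ isT).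
have cF : #|T| * p.-1 <= #|\bigcup_v F v|.
  rewrite -[X in _ <= X]sum1_card partition_disjoint_bigcup // (bigID (mem T)) /=.
  apply: leq_trans (leq_addr _ _); rewrite -sum_nat_const; apply: leq_sum => v vT.
  rewrite sum1_card /F vT; have TvU : T :\ v \subset U by apply: subset_trans (subsetDl _ _) TU.
  have iTv : indep (T :\ v) by apply: indepS iT; exact: subsetDl.
  suff vF : v \in far U (T :\ v) by have := robust_deg (robust_far rU TvU iTv) vF; rewrite /P; card_lia.
  apply/farP; split; rewrite ?setD1_neq ?eqxx ?andbF ?(subsetP TU) //.
  by move=> z; rewrite setD1_neq => /andP[zT _]; exact: (indepP _ iT).
have dC : [disjoint C & \bigcup_v F v].
  rewrite disjoint_subset; apply/subsetP => x /CP[_ hx]; rewrite inE.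
  apply/negP => /bigcupP[v _]; rewrite /F; case: ifP => vT; last by rewrite inE.
  case/(PP _ vT) => _ _ _ h.
  have /set0Pn[w] : T :\ v != set0.
    by rewrite -cards_eq0; have := cardsD1 v T; rewrite vT; card_lia.
  by rewrite setD1_neq => /andP[wT wv]; move: (h _ wT wv); rewrite hx.
have sub : C :|: \bigcup_v F v \subset nbrs_of U T.
  apply/subsetP => x /setUP[/CP[xU hx]|/bigcupP[v _]].
    rewrite inE xU; have /card_gt0P[z zT] := ltnW T2.
    by apply/exists_inP; exists z => //; exact: hx.
  rewrite /F; case: ifP => vT; last by rewrite inE.
  by case/(PP _ vT) => xU _ vx _; rewrite inE xU; apply/exists_inP; exists v.
have := subset_leq_card sub; rewrite cardsU (disjoint_setI0 dC) cards0 subn0.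
have -> : p * #|T| = #|T| + #|T| * p.-1 by rewrite mulnC -{1}(prednK p0) mulnS.
by apply: leq_trans; exact: leq_add minimal_obstruction cF.
Qed.

End MinimalObstruction.


(** * Independent sets have many neighbours *)

(* Peel off from [A] either a vertex with at least [p] private neighbours or the
   set of neighbours in [A] of a vertex seeing as few of them as possible, at least two. *)
Lemma quasi_regularizable p U a A : 0 < p -> p != 2 -> robust p U a ->
  A \subset U -> indep A -> {in A, forall v, p <= #|nbrs U v|} ->
  p * #|A| <= #|nbrs_of U A|.
Proof.
move=> p0 p2 rU; have [n le] := ubnP #|A|; elim: n => // n IH in A le *.
move=> AU iA degA.
(* The induction hypothesis handles [A :\: T]; [nbrs_of_split] leaves only the new neighbours of [T]
   to count. *)
have step T : T \subset A -> 0 < #|T| ->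
    p * #|T| <= #|nbrs_of (far U (A :\: T)) T| -> p * #|A| <= #|nbrs_of U A|.
  move=> TA T0 leT; rewrite (nbrs_of_split _ TA iA).
  have cAT : #|A :\: T| = #|A| - #|T| by rewrite cardsD (setIidPr TA).
  have leTA := subset_leq_card TA.
  have : p * #|A :\: T| <= #|nbrs_of U (A :\: T)|.
    apply: IH.
    - by rewrite cAT; card_lia.
    - by apply: subset_trans AU; exact: subsetDl.
    - by apply: indepS iA; exact: subsetDl.
    - by move=> v /setDP[vA _]; exact: degA.
  rewrite cAT mulnBr; have := leq_mul (leqnn p) leTA; card_lia.
case: (boolP [exists v in A, p <= #|nbrs (far U (A :\ v)) v|]) => [/exists_inP[v vA lev]|].
  apply: (step [set v]); rewrite ?sub1set ?cards1 ?muln1 //.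
  apply: leq_trans lev _; apply: subset_leq_card; apply/subsetP => x.
  rewrite !inE => /andP[-> vx] /=; by apply/exists_inP; exists v; rewrite ?inE.
rewrite negb_exists_in => /forall_inP privA.
have [->|/set0Pn[v vA]] := eqVneq A set0; first by rewrite cards0 muln0.
pose M c := [set z in A | adj z c].
(* The degree of [v] is at least [p] but fewer than [p] of its neighbours are private, so some [c0]
   is seen by a second vertex of [A]. *)
have /subsetPn[c0 c0v c0n] : ~~ (nbrs U v \subset nbrs (far U (A :\ v)) v).
  apply: contra (privA v vA) => /subset_leq_card; exact: leq_trans (degA v vA).
have Pc0 : (c0 \in U) && (1 < #|M c0|).
  move: c0v c0n; rewrite inE => /andP[c0U vc0]; rewrite inE vc0 andbT => h.
  rewrite c0U /=; have /existsP[w /andP[wA wc]] : [exists w in A :\ v, adj w c0].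
    rewrite -[X in is_true X]negbK negb_exists_in; apply: contra h => /forall_inP h.
    apply/farP; split=> //; apply: contraL vc0; rewrite setD1_neq => /andP[cA _].
    exact: (indepP _ iA).
  move: wA; rewrite setD1_neq => /andP[wA wv].
  apply: leq_trans (subset_leq_card (_ : [set v; w] \subset _)).
    by rewrite cards2 eq_sym wv.
  by rewrite subUset !sub1set !inE vA wA vc0.
case: (@arg_minnP _ c0 (fun c => (c \in U) && (1 < #|M c|)) (fun c => #|M c|) Pc0) => c /andP[cU Mc] minc.
set T := M c.
have TA : T \subset A by apply/subsetP => z; rewrite inE => /andP[].
have TP z : z \in T -> z \in A /\ adj z c by rewrite inE => /andP[].
apply: (step T TA); first exact: ltnW.
set U' := far U (A :\: T).
have iT : indep T := indepS TA iA.
have AT_U : A :\: T \subset U by apply: subset_trans AU; exact: subsetDl.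
have iAT : indep (A :\: T) by apply: indepS iA; exact: subsetDl.
have TU' : T \subset U'.
  apply/subsetP => z zT; have [zA _] := TP z zT; apply/farP; split.
  - exact: (subsetP AU).
  - by rewrite inE zT.
  - by move=> w /setDP[wA _]; exact: (indepP _ iA).
have cU' : c \in U'.
  apply/farP; split=> //.
    apply/negP => /setDP[cA _]; have /card_gt0P[z /TP[zA zc]] := ltnW Mc.
    by move: (indepP _ iA _ _ zA cA); rewrite zc.
  by move=> z /setDP[zA]; rewrite inE zA.
apply: (minimal_obstruction_nbrs p0 p2 (robust_far rU AT_U iAT) TU' iT Mc (c := c)).
(* A neighbour private for [T] within [U'] is private for [A] within [U]. *)
- move=> w /TP[wA _]; have := privA w wA; rewrite -ltnNge.
  apply: leq_ltn_trans; apply: subset_leq_card; apply/subsetP => x.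
  rewrite inE => /andP[/farP[/farP[xU xAT hAT] xT hT] wx]; rewrite inE wx andbT.
  apply/farP; split=> //.
    by apply: contraL wx; rewrite setD1_neq => /andP[xA _]; exact: (indepP _ iA).
  move=> z; rewrite setD1_neq => /andP[zA zw].
  case: (boolP (z \in T)) => zT; first by apply: hT; rewrite setD1_neq zT.
  by apply: hAT; rewrite inE zT.
(* Inside [U'], [M u] is contained in [T]. If it has two elements, the minimal choice of [c] makes
   it all of [T]. *)
- move=> u x w z /farP[uU uA hu] xT wT zT xw xu wu.
  have sub : M u \subset T.
    apply/subsetP => y; rewrite inE => /andP[yA yu]; apply: contraLR yu => yT.
    by apply: hu; rewrite inE yT.
  have eT : M u = T.
    apply/eqP; rewrite eqEcard sub; apply: minc; rewrite uU /=.
    have [xA wA] := ((TP x xT).1, (TP w wT).1).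
    apply: leq_trans (subset_leq_card (_ : [set x; w] \subset _)).
      by rewrite cards2 xw.
    by rewrite subUset !sub1set !inE xA wA xu.
  by move: zT; rewrite -eT inE => /andP[].
- by rewrite inE cU'; apply/forall_inP => z /TP[].
Qed.

(** A vertex of smaller degree would form with its neighbours a clique closed under adjacency, hence
    the whole connected graph, leaving no two independent vertices. *)
Lemma connected_min_deg p : 0 < p -> connected_graph G -> 1 < alpha G ->
  robust p [set: G] (alpha G) -> forall v, p <= #|nbrs [set: G] v|.
Proof.
move=> p0 conn a1 rG v; rewrite leqNgt; apply/negP => lt.
have vT : v \in [set: G] by rewrite inE.
pose K := v |: nbrs [set: G] v.
have sK : closed (@adj G) (mem K).
  apply: intro_closed => [|x y xy]; first exact: sym_connect_sym (@adj_sym G).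
  case/setU1P => [ex|xN]; first by rewrite !inE -ex xy orbT.
  case: (eqVneq y v) => [->|yv]; first by rewrite !inE eqxx.
  have := min_deg_closed (y := y) rG vT lt xN; rewrite !inE xy => /(_ isT yv) ->.
  exact: orbT.
have inK x : x \in K by rewrite -(closed_connect sK (conn v x)) setU11.
have [||S [/indepP iS _ _ _ cS]] := rG.2 set0 set0 (indep0 G) (sub0set _).
- by rewrite cards0.
- by rewrite -setI_eq0 setI0.
rewrite -cS in a1; case/card_gt1P: a1 => x [y [xS yS xy]].
have := iS _ _ xS yS; case/setU1P: (inK x) => [ex|xN]; case/setU1P: (inK y) => [ey|yN].
- by rewrite ex ey eqxx in xy.
- by move: yN; rewrite inE -ex => /andP[_ ->].
- by move: xN; rewrite inE adj_sym -ey => /andP[_ ->].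
- by rewrite (min_deg_clique rG vT lt xN yN xy).
Qed.

(** * Counting one-point extensions *)

(** Double counting of the independent sets of size [k.+1] with a marked vertex [x]: removing or
    adjoining [x] matches them with the pairs of an independent [A] of size [k] and an [x] far from
    it. *)
Lemma card_indep_succ k :
  k.+1 * nb_indep G k.+1 =
    \sum_(A in [set A : {set G} | indep A & #|A| == k]) #|far [set: G] A|.
Proof.
rewrite /nb_indep mulnC -sum_nat_const.
transitivity (\sum_(B in [set B : {set G} | indep B & #|B| == k.+1]) \sum_(x in B) 1).
  by apply: eq_bigr => B; rewrite inE sum1_card => /andP[_ /eqP].
under [RHS]eq_bigr do rewrite -sum1_card.
rewrite (exchange_big_dep xpredT) //= [RHS](exchange_big_dep xpredT) //=.
apply: eq_bigr => x _; rewrite !sum1dep_card.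
set D := [set A | _ & x \in far _ A].
have DP A : A \in D -> [/\ indep A, #|A| = k & x \in far [set: G] A].
  by rewrite inE => /andP[]; rewrite inE => /andP[? /eqP ?].
rewrite -(@card_in_imset _ _ (fun A => x |: A) (mem D)).
  apply: eq_card => B; apply/idP/imsetP.
    rewrite !inE => /andP[/andP[iB /eqP cB] xB]; exists (B :\ x); last by rewrite setD1K.
    have := cardsD1 x B; rewrite xB cB => /eqP; rewrite add1n eqSS eq_sym => cBx.
    rewrite !inE cBx eqxx (indepS _ iB) ?subsetDl //=; apply/forall_inP => y /setD1P[_ yB].
    exact: (indepP _ iB).
  case=> A /DP[iA cA /farP[_ xA h]] ->.
  rewrite !in_set cardsU1 xA cA add1n set11 eqxx !andbT.
  by apply: indepU1 => // y yA; rewrite adj_sym h.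
move=> A B /DP[_ _ /farP[_ xA _]] /DP[_ _ /farP[_ xB _]] e.
by rewrite -(setU1K xA) e setU1K.
Qed.

Lemma nb_indep_lower p k : robust p [set: G] (alpha G) ->
  p * (alpha G - k) * nb_indep G k <= k.+1 * nb_indep G k.+1.
Proof.
move=> rG; rewrite card_indep_succ mulnC /nb_indep -sum_nat_const.
apply: leq_sum => A; rewrite inE => /andP[iA /eqP <-].
exact: robust_card (robust_far rG (subsetT _) iA).
Qed.

(** The subtracted term stands on the left to avoid truncated subtraction. *)
Lemma nb_indep_upper p k : 0 < p -> p != 2 -> connected_graph G -> 1 < alpha G ->
  robust p [set: G] (alpha G) ->
  k.+1 * nb_indep G k.+1 + p.+1 * k * nb_indep G k <= #|G| * nb_indep G k.
Proof.
move=> p0 p2 conn a1 rG; rewrite card_indep_succ !(mulnC _ (nb_indep G k)).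
rewrite /nb_indep -!sum_nat_const -big_split; apply: leq_sum => A.
rewrite inE => /andP[iA /eqP cA].
have := quasi_regularizable p0 p2 rG (subsetT A) iA.
move=> /(_ (fun v _ => connected_min_deg p0 conn a1 rG v)).
by have := card_far (subsetT A) iA; rewrite cardsT mulSn cA /= => -> ; card_lia.
Qed.

End Robust.

Local Open Scope ring_scope.

(** * Real estimates and the conclusion *)

(* [q * (a + 1) / k + k] is least at [k = sqrt (q * (a + 1))]; in the second case
   that point lies beyond [a - 1], which is then the worst value of [k]. *)
Lemma ratio_bound (R : rcfType) (n a q k : R) : 0 <= q -> 1 <= k -> k <= a - 1 ->
  (a ^+ 2 / (4 * (a + 1)) <= q /\
   n \in `[(q + 1) * a, q * a + 2 * Num.sqrt (q * a + q)])
  \/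
  (a * (a - 1) / (a + 1) <= q /\
   n \in `]q * a + 2 * Num.sqrt (q * a + q),
           ((a ^+ 2 + 1) * q + (a - 1) ^+ 2) / (a - 1)]) ->
  k * (n - (q + 1) * k) <= q * (a - k + 1) * (k + 1).
Proof.
move=> q0 k1 ka [[_]|[qge]]; rewrite in_itv /= => /andP[_ nle].
  have r0 : 0 <= q * a + q by rewrite addr_ge0 // mulr_ge0 //; lra.
  have := sqr_sqrtr r0; set r := Num.sqrt _ in nle * => er.
  have : k * n <= k * (q * a + 2 * r) by rewrite ler_pM2l //; lra.
  (* As [r ^+ 2 = q * (a + 1)], this square bounds [2 * k * r] by [k ^+ 2 + q * (a + 1)]. *)
  have := sqr_ge0 (k - r); lra.
have a1 : 0 < a - 1 by lra.
rewrite ler_pdivlMr // in nle; rewrite ler_pdivrMr in qge; last by lra.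
rewrite -(ler_pM2r a1).
have h1 : k * (n * (a - 1)) <= k * ((a ^+ 2 + 1) * q + (a - 1) ^+ 2).
  by rewrite ler_pM2l //; lra.
(* The product is [k * (a - 1)] times the amount by which [q * a + q * (a + 1) / k + k] exceeds its
   value at [a - 1], which is the upper end of the interval for [n]. *)
have h2 : 0 <= (a - 1 - k) * (q * (a + 1) - k * (a - 1)).
  apply: mulr_ge0; first by lra.
  have : k * (a - 1) <= a * (a - 1) by rewrite ler_pM2r //; lra.
  lra.
lra.
Qed.

Theorem theorem3p3 (R : rcfType) (p : nat) (G : sgraph)
    (p_gt0 : (0 < p)%N) (p_neq2 : p <> 2%N)
    (G_conn : connected_graph G) (G_Wp : W p G) :
  let n : R := #|G|%:R in
  let a : R := (alpha G)%:R in
  let q : R := p%:R in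
  (a ^+ 2 / (4 * (a + 1)) <= q /\
   n \in `[(q + 1) * a, q * a + 2 * Num.sqrt (q * a + q)])
  \/
  (a * (a - 1) / (a + 1) <= q /\
   n \in `]q * a + 2 * Num.sqrt (q * a + q),
           ((a ^+ 2 + 1) * q + (a - 1) ^+ 2) / (a - 1)]) ->
  log_concave (indep_poly G).
Proof.
move=> n a q hyp k; rewrite size_indep_poly /= => /andP[k0 ka].
(* The middle index becomes [k.+1]: the lower bound is used at [k], the upper one at [k.+1]. *)
case: k k0 ka => // k _ ka.
rewrite !coef_indep_poly.
have a1 : (1 < alpha G)%N by apply: leq_ltn_trans ka.
have rG := robust_W p_gt0 G_Wp.
have lo := nb_indep_lower k rG.
have up := nb_indep_upper k.+1 p_gt0 (introN eqP p_neq2) G_conn a1 rG.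
rewrite /= -natrM -natrX ler_nat -(ler_nat R) natrM natrX.
move: lo up; rewrite -!(ler_nat R) natrD !natrM -/q -/n natrB 1?ltnW 1?ltnW // -/a.
set s0 := (nb_indep G k)%:R; set s1 := (nb_indep G k.+1)%:R; set s2 := (nb_indep G k.+2)%:R.
have k1 : (1 : R) <= k.+1%:R by rewrite ler1n.
have kale : k.+1%:R <= a - 1 by rewrite lerBrDr natr1 ler_nat.
have s0_ge0 : 0 <= s0 by exact: ler0n.
have s1_ge0 : 0 <= s1 by exact: ler0n.
have s2_ge0 : 0 <= s2 by exact: ler0n.
have q_gt0 : 0 < q by rewrite ltr0n.
have := ratio_bound (ltW q_gt0) k1 kale hyp.
have -> : k.+2%:R = k.+1%:R + 1 :> R by rewrite natr1.
have -> : p.+1%:R = q + 1 by rewrite /q natr1.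
have -> : k%:R = k.+1%:R - 1 :> R by rewrite -natr1 addrK.
set x := k.+1%:R in k1 kale *.
move=> ratio lo up.
(* This is the coefficient of [s0 * s2] in the product of the two bounds; [ratio] bounds the
   coefficient of [s1 ^+ 2] by it. *)
have c_gt0 : 0 < q * (a - x + 1) * (x + 1) by rewrite !mulr_gt0 //; lra.
rewrite -(ler_pM2l c_gt0).
have lo' : q * (a - x + 1) * s0 <= x * s1 by lra.
have up' : (x + 1) * s2 <= (n - (q + 1) * x) * s1 by lra.
have := ler_pM _ _ lo' up'.
rewrite !mulr_ge0 //; try lra.
move=> /(_ isT isT) prod.
have := ler_wpM2r (sqr_ge0 s1) ratio; lra.
Qed.
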